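(* Let $k,n,t$ be positive integers. Then $$\sum_{\pi\in NC^k(n)} \#\{V\in\pi : |V| = tk\} \;=\; \binom{n(k+1)-t-1}{nk-1}.$$
   Context: A partition of a finite set $S$ is a set of pairwise disjoint non-empty subsets (blocks) of $S$ whose union is $S$. A partition $\pi$ of $[N]=\{1,\dots,N\}$ is non-crossing if there are no $1\le a<b<c<d\le N$ with $a,c$ in one block and $b,d$ in a different block. $NC^k(n)$ denotes the set of non-crossing partitions of $[kn]$ all of whose blocks have size divisible by $k$. Binomial coefficients: for integers $a,b$, $\binom{a}{b}=\frac{a!}{b!(a-b)!}$ if $0\le b\le a$ and $\binom{a}{b}=0$ otherwise. *)

(* Defs.v *)
From mathcomp Require Import all_boot all_order all_algebra.
Set Implicit Arguments. Unset Strict Implicit. Unset Printing Implicit Defensive.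
Import GRing.Theory Num.Theory.

(* Partitions of [N] are represented on 'I_N = {0,...,N-1} (shift by one);
   the order on 'I_N is the usual one, so non-crossingness is unaffected. *)

Definition is_set_partition (N : nat) (P : {set {set 'I_N}}) : bool :=
  partition P [set: 'I_N].

Definition noncrossing (N : nat) (P : {set {set 'I_N}}) : bool :=
  [forall a : 'I_N, forall b : 'I_N, forall c : 'I_N, forall d : 'I_N,
    forall B1 in P, forall B2 in P,
      ~~ [&& (a < b)%N, (b < c)%N, (c < d)%N, B1 != B2,
             a \in B1, c \in B1, b \in B2 & d \in B2]].

Definition in_NCk (k n : nat) (P : {set {set 'I_(k * n)}}) : bool :=
  [&& is_set_partition P, noncrossing P & [forall B in P, k %| #|B|]].

Definition binomZ (a b : int) : nat :=
  if (0 <= b)%R && (b <= a)%R then 'C(`|a|%N, `|b|%N) else 0.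

(* Main.v *)
(* Read the points from left to right and close each block at its maximum. For a
   non-crossing partition, the block closed at a point consists of the top m of the
   points still open there, so it is determined by its size m. Let G(L,r) and H(L,r)
   be the number of configurations of closed blocks with total size k*r after L
   points, and the total number of their blocks of size t*k. For k*r <= L+1,
     G(L+1,r) = sum_(j <= r) G(L,j),   H(L+1,r) = sum_(j <= r) H(L,j) + G(L,r-t),
   and both recurrences are solved, within the range k*r <= L+1, by
     G(L,r) = C(L+r,L) - k C(L+r,L+1),   H(L,t+s) = (L+1-k(t+s)) C(L+s-1,s).
   The theorem is the case L = kn, r = n of the second formula. *)
Require Import Defs.
From mathcomp Require Import all_boot all_order all_algebra.
From mathcomp Require Import zify.

Set Implicit Arguments. Unset Strict Implicit. Unset Printing Implicit Defensive.

(** * Upper parts of a finite set of points *)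

Definition upper_in (N : nat) (A T : {set 'I_N}) : Prop :=
  forall x y : 'I_N, x \in T -> y \in A -> x < y -> y \in T.

Definition top (N m : nat) (A : {set 'I_N}) : {set 'I_N} :=
  [set x in A | #|[set y in A | x < y]| < m].

(** Above a point of [T] lie at most the other points of [T], while above a point of [A] outside [T]
    lies all of [T]. An upper part is thus determined by its size. *)
Lemma upper_in_top (N : nat) (A T : {set 'I_N}) :
  T \subset A -> upper_in A T -> T = top #|T| A.
Proof.
move=> /subsetP sTA upT; apply/setP=> x; rewrite inE.
apply/idP/andP => [xT | [xA]].
  split; first exact: sTA.
  apply: proper_card; apply/properP; split.
    by apply/subsetP=> y; rewrite inE => /andP[yA xy]; apply: upT xT yA xy.
  by exists x; rewrite ?inE // ltnn andbF.
apply: contraLR => xNT; rewrite -leqNgt; apply: subset_leq_card.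
apply/subsetP=> y yT; rewrite inE sTA //=.
case: (ltngtP x y) => // [yx | /val_inj xy]; last by rewrite xy yT in xNT.
by rewrite (upT y x) in xNT.
Qed.

Lemma exists_upper_in (N m : nat) (A : {set 'I_N}) : m <= #|A| ->
  exists T : {set 'I_N}, [/\ T \subset A, #|T| = m & upper_in A T].
Proof.
elim: m => [_ | m IHm ltmA].
  by exists set0; split; rewrite ?sub0set ?cards0 // => x y; rewrite inE.
have [T [sTA cT upT]] := IHm (ltnW ltmA).
have /card_gt0P[z0 z0AT] : 0 < #|A :\: T|.
  by rewrite cardsD (setIidPr sTA) cT subn_gt0.
case: (@arg_maxnP _ z0 (fun z => z \in A :\: T) (fun z => z : nat) z0AT) => z.
rewrite in_setD => /andP[zNT zA] zmax; exists (z |: T); split.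
- by rewrite subUset sub1set zA.
- by rewrite cardsU1 zNT cT.
- move=> x y; rewrite !inE => /orP[/eqP -> | xT] yA xy; last first.
    by rewrite (upT x) ?orbT.
  case: (boolP (y \in T)) => yT; first by rewrite orbT.
  have: y <= z by apply: zmax; rewrite inE yT.
  by rewrite leqNgt xy.
Qed.

(** Existence of an upper part of size [m] and its uniqueness give the size of [top m A] without
    counting ranks. *)
Lemma top_spec (N m : nat) (A : {set 'I_N}) : m <= #|A| ->
  [/\ top m A \subset A, #|top m A| = m & upper_in A (top m A)].
Proof.
by move=> /exists_upper_in[T [sTA cT upT]]; rewrite -cT -(upper_in_top sTA upT).
Qed.

(** * Configurations of closed blocks *)

(* Non-crossing, with no open point left under an arc of a closed block: a point
   b outside B between two points a < c of B lies in a block closed before c. *)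
Definition nested (N : nat) (P : {set {set 'I_N}}) : bool :=
  [forall B in P, forall a in B, forall c in B, forall b : 'I_N,
    [&& a < b, b < c & b \notin B] ==>
    [exists B2 in P, (b \in B2) && [forall d in B2, (d : 'I_N) < c]]].

Lemma nestedP (N : nat) (P : {set {set 'I_N}}) :
  reflect (forall (B : {set 'I_N}) (a b c : 'I_N), B \in P -> a \in B -> c \in B ->
             a < b -> b < c -> b \notin B ->
             exists B2 : {set 'I_N},
               [/\ B2 \in P, b \in B2 & forall d : 'I_N, d \in B2 -> d < c])
          (nested P).
Proof.
apply: (iffP forall_inP) => [h B a b c BP aB cB ab bc bB | h B BP].
  have /forall_inP/(_ a aB)/forall_inP/(_ c cB)/forallP/(_ b) := h B BP.
  rewrite ab bc bB => /exists_inP[B2 B2P /andP[bB2 /forall_inP dB2]].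
  by exists B2; split.
apply/forall_inP=> a aB; apply/forall_inP=> c cB; apply/forallP=> b.
apply/implyP=> /and3P[ab bc bB].
have [B2 [B2P bB2 dB2]] := h B a b c BP aB cB ab bc bB.
by apply/exists_inP; exists B2; rewrite // bB2; apply/forall_inP.
Qed.

Definition below (N L : nat) : {set 'I_N} := [set x : 'I_N | x < L].

Lemma card_below (N L : nat) : L <= N -> #|below N L| = L.
Proof.
move=> leLN; have -> : below N L = [set widen_ord leLN i | i : 'I_L].
  apply/setP=> x; rewrite inE; apply/idP/imsetP => [xL | [i _ ->]].
    by exists (Ordinal xL) => //; apply: val_inj.
  exact: (ltn_ord i).
by rewrite card_imset ?card_ord // => i j /(congr1 val) /= /val_inj.
Qed.

(** [P] is the set of blocks closed after [L] points; the points below [L] outside [cover P] are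
    still open. *)
Definition config (N k L r : nat) (P : {set {set 'I_N}}) : bool :=
  [&& trivIset P, set0 \notin P, cover P \subset below N L, #|cover P| == k * r,
      [forall B in P, k %| #|B|] & nested P].

Lemma configP (N k L r : nat) (P : {set {set 'I_N}}) :
  reflect [/\ trivIset P /\ set0 \notin P, cover P \subset below N L,
              #|cover P| = k * r, (forall B : {set 'I_N}, B \in P -> k %| #|B|) & nested P]
          (config k L r P).
Proof.
apply: (iffP idP) => [|[[h1 h2] h3 h4 h5 h6]].
  by move=> /and5P[h1 h2 h3 /eqP h4 /andP[/forall_inP h5 h6]].
by rewrite /config h1 h2 h3 h4 eqxx h6 andbT; apply/forall_inP.
Qed.

Lemma mem_cover (N : nat) (P : {set {set 'I_N}}) (B : {set 'I_N}) (x : 'I_N) :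
  B \in P -> x \in B -> x \in cover P.
Proof. by move=> BP xB; apply/bigcupP; exists B. Qed.

Lemma cover_setU1 (N : nat) (T : {set 'I_N}) (P : {set {set 'I_N}}) :
  cover (T |: P) = T :|: cover P.
Proof. by rewrite /cover bigcup_setU big_set1. Qed.

Lemma trivIset_setU1 (N : nat) (T : {set 'I_N}) (P : {set {set 'I_N}}) :
  trivIset P -> [disjoint T & cover P] -> trivIset (T |: P).
Proof.
move=> /trivIsetP tP dT; have dTB B : B \in P -> [disjoint T & B].
  by move=> BP; apply: disjointWr dT; apply: bigcup_sup BP.
apply/trivIsetP=> A B; rewrite !in_setU1.
move=> /orP[/eqP -> | AP] /orP[/eqP -> | BP] neAB.
- by rewrite eqxx in neAB.
- exact: dTB.
- by rewrite disjoint_sym dTB.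
- exact: tP.
Qed.

(** * Closing a block at the point [L], and undoing it *)

Definition last_block (N k L j : nat) (P : {set {set 'I_N}}) : {set 'I_N} :=
  top (k * j) (below N L.+1 :\: cover P).

Lemma card_uncovered (N k L r : nat) (P : {set {set 'I_N}}) : L < N ->
  config k L r P -> #|below N L.+1 :\: cover P| = L.+1 - k * r.
Proof.
move=> ltLN /configP[_ sub cP _ _].
rewrite cardsD (setIidPr _) ?card_below ?cP //.
by apply: (subset_trans sub); apply/subsetP=> x; rewrite !inE => /ltnW.
Qed.

Lemma last_block_spec (N k L r j : nat) (P : {set {set 'I_N}}) : L < N ->
  config k L r P -> k * (r + j) <= L.+1 ->
  [/\ last_block k L j P \subset below N L.+1 :\: cover P,
      #|last_block k L j P| = k * j &
      upper_in (below N L.+1 :\: cover P) (last_block k L j P)].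
Proof.
move=> ltLN cfg le; apply: top_spec; rewrite (card_uncovered ltLN cfg); nia.
Qed.

Lemma add_last_config (N k L r j : nat) (P : {set {set 'I_N}}) (ltLN : L < N) :
  0 < k -> 0 < j -> config k L r P -> k * (r + j) <= L.+1 ->
  Ordinal ltLN \in last_block k L j P /\
  config k L.+1 (r + j) (last_block k L j P |: P).
Proof.
move=> k0 j0 cfg le; have [sT cT upT] := last_block_spec ltLN cfg le.
set T := last_block k L j P in sT cT upT *.
move/configP: cfg => [[tP P0] /subsetP sub cP dvP /nestedP nP].
have /card_gt0P[x xT] : 0 < #|T| by rewrite cT muln_gt0 k0.
have dT : [disjoint T & cover P].
  by move: sT; rewrite subsetD => /andP[].
have ltT y : y \in T -> y < L.+1.
  by move=> /(subsetP sT); rewrite !inE => /andP[].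
(* [L] is open, since [cover P] lies below [L], and it exceeds every other candidate; so the
   non-empty upper set [T] contains it. *)
have oT : Ordinal ltLN \in T.
  have /= := ltT x xT; rewrite ltnS leq_eqVlt => /orP[/eqP xL | xL].
    by have <- : x = Ordinal ltLN by apply: val_inj.
  apply: (upT x (Ordinal ltLN) xT) => //; rewrite !inE /= ltnSn andbT.
  by apply/negP=> /sub; rewrite inE /= ltnn.
split=> //; apply/configP; split.
- split; first exact: trivIset_setU1.
  rewrite in_setU1 negb_or P0 andbT eq_sym; apply/set0Pn; by exists x.
- rewrite cover_setU1; apply/subsetP=> y; rewrite in_setU => /orP[/ltT yL | /sub].
    by rewrite inE.
  by rewrite !inE => /ltnW.
- rewrite cover_setU1 cardsU (disjoint_setI0 dT) cards0 cT cP; lia.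
- by move=> B; rewrite in_setU1 => /orP[/eqP -> | /dvP //]; rewrite cT dvdn_mulr.
- apply/nestedP=> B a b c; rewrite in_setU1 => /orP[/eqP -> aT cT' ab bc bT | BP aB cB ab bc bB].
    case: (boolP (b \in cover P)) => [/bigcupP[B2 B2P bB2] | bP]; last first.
      have: b \in T.
        apply: upT aT _ ab; rewrite !inE bP /=.
        exact: ltn_trans bc (ltT c cT').
      by rewrite (negPf bT).
    (* If the old block [B2] of [b] reached beyond [c], then [c] would lie under an arc of [B2],
       hence in a closed block; but [c] was open. *)
    have cNP : c \notin cover P by rewrite (disjointFr dT).
    have cNB2 : c \notin B2 by apply: contra cNP; apply: mem_cover.
    exists B2; split; rewrite ?in_setU1 ?B2P ?orbT // => d dB2.
    rewrite ltnNge leq_eqVlt; apply/negP=> /orP[/eqP/val_inj cd | cd].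
      by rewrite cd dB2 in cNB2.
    have [B3 [B3P cB3 _]] := nP B2 b c d B2P bB2 dB2 bc cd cNB2.
    by rewrite (mem_cover B3P cB3) in cNP.
  have [B2 [B2P bB2 dB2]] := nP B a b c BP aB cB ab bc bB.
  by exists B2; split; rewrite ?in_setU1 ?B2P ?orbT.
Qed.

Lemma cover_setD1 (N : nat) (T : {set 'I_N}) (P : {set {set 'I_N}}) :
  trivIset P -> T \in P -> cover (P :\ T) = cover P :\: T.
Proof.
move=> /trivIsetP tP TP; apply/setP=> x; rewrite in_setD.
apply/bigcupP/andP => [[B] | [xT /bigcupP[B BP xB]]].
  rewrite !inE => /andP[neBT BP] xB; split; last exact: mem_cover BP xB.
  by rewrite (disjointFr (tP B T BP TP neBT) xB).
exists B => //; rewrite !inE BP andbT; apply: contra xT => /eqP <- //.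
Qed.

(** The block of [L] must be a top segment: an open point above some [x] in [T] lies under the arc
    from [x] to [L], where nestedness allows only closed points. *)
Lemma remove_last_config (N k L r j : nat) (P : {set {set 'I_N}}) (T : {set 'I_N})
    (ltLN : L < N) :
  config k L.+1 (r + j) P -> T \in P -> Ordinal ltLN \in T -> #|T| = k * j ->
  config k L r (P :\ T) /\ T = last_block k L j (P :\ T).
Proof.
move=> /configP[[tP P0] /subsetP sub cP dvP /nestedP nP] TP oT cT.
have sTP : T \subset cover P by apply: bigcup_sup TP.
have covE := cover_setD1 tP TP.
have ltP x : x \in cover P -> x < L.+1 by move/sub; rewrite inE.
split.
  apply/configP; split.
  - split; last by rewrite !inE (negPf P0) andbF.
    by apply: trivIsetS tP; apply: subD1set.
  - rewrite covE; apply/subsetP=> x; rewrite in_setD inE => /andP[xT /ltP].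
    rewrite ltnS leq_eqVlt => /orP[/eqP xL | //].
    by rewrite (_ : x = Ordinal ltLN) ?oT // in xT; apply: val_inj.
  - by rewrite covE cardsD (setIidPr sTP) cP cT; lia.
  - by move=> B; rewrite !inE => /andP[_ /dvP].
  - apply/nestedP=> B a b c; rewrite !inE => /andP[neBT BP] aB cB ab bc bB.
    have [B2 [B2P bB2 dB2]] := nP B a b c BP aB cB ab bc bB.
    exists B2; split=> //; rewrite !inE B2P andbT; apply/eqP=> eB2.
    (* The witness cannot be [T], which contains [L], because it ends before [c] and [c] is at most
       [L]. *)
    have: L < c by apply: (dB2 (Ordinal ltLN)); rewrite eB2.
    by move/leq_trans/(_ (ltP c (mem_cover BP cB))); rewrite ltnn.
rewrite /last_block -cT; apply: upper_in_top.
  rewrite covE; apply/subsetP=> x xT; rewrite !inE xT /=.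
  by apply: ltP; apply: (subsetP sTP).
move=> x y xT; rewrite covE !inE negb_and negbK.
move=> /andP[/orP[// | yP]]; rewrite ltnS leq_eqVlt.
move=> /orP[/eqP yL _ | yL xy].
  by rewrite (_ : y = Ordinal ltLN) //; apply: val_inj.
apply/negPn/negP=> yT.
have [B2 [B2P yB2 _]] := nP T x y (Ordinal ltLN) TP xT oT xy yL yT.
by rewrite (mem_cover B2P yB2) in yP.
Qed.

Lemma config_skip (N k L r : nat) (P : {set {set 'I_N}}) (ltLN : L < N) :
  config k L r P = config k L.+1 r P && (Ordinal ltLN \notin cover P).
Proof.
apply/configP/andP => [[h1 /subsetP sub h3 h4 h5] | [/configP[h1 /subsetP sub h3 h4 h5] oP]].
  split; last by apply/negP=> /sub; rewrite inE /= ltnn.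
  by apply/configP; split=> //; apply/subsetP=> x /sub; rewrite !inE => /ltnW.
split=> //; apply/subsetP=> x xP; have := sub x xP; rewrite !inE ltnS leq_eqVlt.
move=> /orP[/eqP xL | //]; rewrite (_ : Ordinal ltLN = x) ?xP // in oP.
exact: val_inj.
Qed.

(** * The recurrences in the number of points *)

(** Either the point [L] stays open, or it closes a block of size [k * (r - i)], and then deleting
    that block is a bijection onto configurations of size [k * i]. The weight [F] is arbitrary so
    that both recurrences follow. *)
Lemma sum_config_rec (N k L r : nat) (F : {set {set 'I_N}} -> nat) :
  0 < k -> L < N -> k * r <= L.+1 ->
  \sum_(P | config k L.+1 r P) F P =
  \sum_(P | config k L r P) F P +
  \sum_(i < r) \sum_(P | config k L i P) F (last_block k L (r - i) P |: P).
Proof.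
move=> k0 ltLN ler; pose o := Ordinal ltLN.
rewrite (bigID (fun P => o \notin cover P)) /=; congr (_ + _).
  by apply: eq_bigl => P; rewrite -config_skip.
pose j (P : {set {set 'I_N}}) := #|pblock P o| %/ k.
have jP (P : {set {set 'I_N}}) : config k L.+1 r P && ~~ (o \notin cover P) ->
    [/\ #|pblock P o| = k * j P, 0 < j P <= r & pblock P o \in P].
  rewrite negbK => /andP[/configP[_ _ cP dvP _] oP].
  have BP := pblock_mem oP; have e : #|pblock P o| = k * j P.
    by rewrite mulnC divnK ?dvP.
  have : #|pblock P o| <= k * r by rewrite -cP subset_leq_card // (bigcup_sup _ BP).
  have : 0 < #|pblock P o| by apply/card_gt0P; exists o; rewrite mem_pblock.
  by rewrite e leq_pmul2l // muln_gt0 => /andP[_ ->] ->.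
(* For [r = 0] no block can contain [L]; otherwise ['I_r.+1] is inhabited, as [inord] requires.
   Since [j P] lies between 1 and [r.+1], the index [r.+1 - j P] is in range and [inord] never takes
   its default value. *)
case: r => [|r] in ler jP *.
  rewrite big_ord0 big_pred0 // => P; apply/negP=> /jP[_]; lia.
rewrite (partition_big (fun P => inord (r.+1 - j P) : 'I_r.+1) xpredT) //=.
apply: eq_bigr => i _.
have ri : i + (r.+1 - i) = r.+1 by rewrite subnKC // ltnW.
rewrite (reindex_onto (fun P => last_block k L (r.+1 - i) P |: P)
                      (fun P => P :\ pblock P o)) /=; last first.
  move=> P /andP[cfg /eqP iE]; have [cB j1 BP] := jP P cfg.
  move: cfg; rewrite negbK => /andP[cfg oP].
  have jE : j P = r.+1 - i.
    by rewrite -iE inordK; [rewrite subKn|]; lia.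
  have oB : o \in pblock P o by rewrite mem_pblock.
  rewrite -ri in cfg; rewrite jE in cB.
  have [_ <-] := remove_last_config cfg BP oB cB.
  by rewrite setD1K.
apply: eq_bigl => P; apply/idP/idP => [/andP[/andP[cfg /eqP iE] /eqP PE] | cfg].
  move: (_ |: P) cfg iE PE => Q cfg iE PE.
  have [cB j1 BP] := jP Q cfg; move: cfg; rewrite negbK => /andP[cfg oP].
  have jE : j Q = r.+1 - i by rewrite -iE inordK; [rewrite subKn|]; lia.
  have oB : o \in pblock Q o by rewrite mem_pblock.
  rewrite -ri in cfg; rewrite jE in cB.
  by have [cfgP _] := remove_last_config cfg BP oB cB; rewrite -PE.
have ji : 0 < r.+1 - i by rewrite subn_gt0.
have lei : k * (i + (r.+1 - i)) <= L.+1 by rewrite ri.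
have [oT cfg'] := add_last_config ltLN k0 ji cfg lei; rewrite ri in cfg'.
have [sT cT _] := last_block_spec ltLN cfg lei.
set T := last_block k L (r.+1 - i) P in oT cfg' sT cT *.
have [tTP _] : trivIset (T |: P) /\ set0 \notin T |: P by case/configP: cfg'.
have BE : pblock (T |: P) o = T by apply: def_pblock => //; rewrite setU11.
rewrite cfg' /= negbK cover_setU1 in_setU oT /= /j BE cT mulKn //.
rewrite (subKn (ltnW (ltn_ord i))) setU1K ?eqxx ?andbT; last first.
  apply/negP=> TP; have := mem_cover TP oT.
  by have := subsetP sT _ oT; rewrite in_setD => /andP[/negPf ->].
by apply/eqP; apply: val_inj; rewrite /= inordK.
Qed.

Definition nb_config (N k L r : nat) : nat :=
  \sum_(P : {set {set 'I_N}} | config k L r P) 1.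

Definition nb_blocks (N k t L r : nat) : nat :=
  \sum_(P : {set {set 'I_N}} | config k L r P) #|[set B in P | #|B| == t * k]|.

Lemma config_le (N k L r : nat) (P : {set {set 'I_N}}) :
  L <= N -> config k L r P -> k * r <= L.
Proof.
by move=> leLN /configP[_ /subset_leq_card + <- _ _]; rewrite card_below.
Qed.

Lemma config0 (N k : nat) (P : {set {set 'I_N}}) : config k 0 0 P = (P == set0).
Proof.
apply/configP/eqP => [[[_ P0] sub _ _ _] | ->].
  apply/eqP; rewrite -subset0; apply/subsetP=> B BP.
  have [B0 | [x xB]] := set_0Vmem B; first by rewrite -B0 BP in P0.
  by have := subsetP sub x (mem_cover BP xB); rewrite inE.
have c0 : cover (set0 : {set {set 'I_N}}) = set0 by rewrite /cover big_set0.
split; rewrite ?c0 ?sub0set ?cards0 ?muln0 //.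
- by split; [apply/trivIsetP=> A B; rewrite inE | rewrite inE].
- by move=> B; rewrite inE.
- by apply/nestedP=> B a b c; rewrite inE.
Qed.

Lemma nb_blocks_lt (N k t L r : nat) : 0 < k -> r < t -> nb_blocks N k t L r = 0.
Proof.
move=> k0 rt; apply: big1 => P /configP[_ _ cP _ _]; apply/eqP.
rewrite cards_eq0 -subset0; apply/subsetP=> B; rewrite inE => /andP[BP /eqP cB].
have : #|B| <= #|cover P| by apply/subset_leq_card/bigcup_sup.
by rewrite cB cP mulnC leq_pmul2l // leqNgt rt.
Qed.

Lemma sum_config_eq0 (N k L r : nat) (F : {set {set 'I_N}} -> nat) :
  L <= N -> L < k * r -> \sum_(P | config k L r P) F P = 0.
Proof.
by move=> leLN ltr; apply: big1 => P /(config_le leLN); rewrite leqNgt ltr.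
Qed.

Lemma nb_config_rec (N k L r : nat) : 0 < k -> L < N -> k * r <= L.+1 ->
  nb_config N k L.+1 r = \sum_(i < r.+1) nb_config N k L i.
Proof.
by move=> k0 ltLN le; rewrite /nb_config sum_config_rec // big_ord_recr addnC.
Qed.

Lemma nb_blocks_rec (N k t L s : nat) :
  0 < k -> 0 < t -> L < N -> k * (t + s) <= L.+1 ->
  nb_blocks N k t L.+1 (t + s) =
  \sum_(i < s.+1) nb_blocks N k t L (t + i) + nb_config N k L s.
Proof.
move=> k0 t0 ltLN le; rewrite /nb_blocks sum_config_rec // -/(nb_blocks N k t L (t + s)).
(* The new block has size [t * k] exactly when [t + s - i = t]. *)
have step (i : 'I_(t + s)) (P : {set {set 'I_N}}) : config k L i P ->
    #|[set B in last_block k L (t + s - i) P |: P | #|B| == t * k]| =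
    #|[set B in P | #|B| == t * k]| + (i == s :> nat).
  move=> cfg; have ji : 0 < t + s - i by rewrite subn_gt0.
  have lei : k * (i + (t + s - i)) <= L.+1 by rewrite subnKC // ltnW.
  have [oT _] := add_last_config ltLN k0 ji cfg lei.
  have [sT cT _] := last_block_spec ltLN cfg lei.
  set T := last_block k L (t + s - i) P in oT sT cT *.
  have TP : T \notin P.
    apply/negP=> TP; have := mem_cover TP oT.
    by have := subsetP sT _ oT; rewrite in_setD => /andP[/negPf ->].
  have cTE : (#|T| == t * k) = (i == s :> nat).
    by rewrite cT mulnC eqn_pmul2r //; have := ltn_ord i; lia.
  case: (boolP (i == s :> nat)) cTE => _ cTE.
    (* The summand 1 is recast as the boolean [T \notin _] that [cardsU1] expects. *)
    rewrite addn1 -add1n -[1 + _]/(true + _).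
    have -> : true = (T \notin [set B in P | #|B| == t * k]) by rewrite inE (negPf TP).
    rewrite -cardsU1; apply: eq_card => B; rewrite !inE.
    by case: eqP => [-> | _] //=; rewrite cTE.
  rewrite addn0; apply: eq_card => B; rewrite !inE.
  by case: eqP => [-> | _] //=; rewrite cTE andbF.
under eq_bigr => i _.
  under eq_bigr => P cfg do rewrite step //.
  rewrite big_split /= -/(nb_blocks N k t L i).
  over.
rewrite big_split /= addnA; congr (_ + _).
  (* The term with [L] open is the missing last term of the sum; the first [t] terms vanish, being
     too small to contain a block of size [t * k]. *)
  transitivity (\sum_(i < (t + s).+1) nb_blocks N k t L i).
    by rewrite big_ord_recr addnC.
  rewrite -addnS big_split_ord /= big1 ?add0n // => i _.
  exact: nb_blocks_lt.
have lts : s < t + s by rewrite -[X in X < _]add0n ltn_add2r.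
rewrite (bigD1 (Ordinal lts)) //= eqxx [X in _ + X]big1 ?addn0 // => i /negPf nis.
by apply: big1 => P _; rewrite -[_ == s]/(i == Ordinal lts) nis.
Qed.

(** * Binomial sums and the solution of the recurrences *)

(** Hockey-stick identity; [L <= m] makes the terms missing at the lower end zero. *)
Lemma sum_bin_diag (L m r : nat) : L <= m ->
  \sum_(i < r.+1) 'C(L + i, m) = 'C(L.+1 + r, m.+1).
Proof.
move=> Lm; elim: r => [|r IHr].
  by rewrite big_ord1 !addn0 binS (@bin_small L m.+1) ?ltnS.
by rewrite big_ord_recr IHr /= !addSnnS [in RHS]addnS binS addnC.
Qed.

Lemma mulSn_bin_diag (L s : nat) : L.+1 * 'C(L + s, L.+1) = s * 'C(L + s, L).
Proof. by rewrite mul_bin_left addKn. Qed.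

(** The ballot-type formula for G vanishes on the line [k * r = L.+1], just outside the range where
    configurations exist. *)
Lemma mul_bin_diag_eq (k L r : nat) : k * r = L.+1 ->
  k * 'C(L + r, L.+1) = 'C(L + r, L).
Proof.
case: r => [|r] kr; first by rewrite muln0 in kr.
have := mulSn_bin_diag L r.+1; rewrite -[X in X * _ = _]kr (mulnC k) -mulnA.
by move/eqP; rewrite eqn_pmul2l // => /eqP.
Qed.

(** Stated additively to avoid truncated subtraction. Including the boundary [k * r = L.+1], where
    both sides of the formula for G are 0, keeps every term of the recurrence within the induction
    hypothesis. *)
Lemma nb_configE (N k L r : nat) : 0 < k -> L <= N -> k * r <= L.+1 ->
  nb_config N k L r + k * 'C(L + r, L.+1) = 'C(L + r, L).
Proof.
move=> k0; elim: L r => [|L IHL] r leLN; rewrite leq_eqVlt => /orP[/eqP kr|].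
- by rewrite /nb_config sum_config_eq0 ?kr // [LHS]add0n; apply: mul_bin_diag_eq kr.
- rewrite ltnS leqn0 muln_eq0 (gtn_eqF k0) => /eqP ->.
  rewrite /nb_config (eq_bigl (pred1 set0)) ?big_pred1_eq ?muln0 // => P.
  exact: config0.
- by rewrite /nb_config sum_config_eq0 ?kr // [LHS]add0n; apply: mul_bin_diag_eq kr.
rewrite ltnS => le; rewrite nb_config_rec // -!(@sum_bin_diag L) // big_distrr -big_split.
apply: eq_bigr => i _; apply: IHL; first exact: ltnW.
by apply: leq_trans le; rewrite leq_mul2l -ltnS ltn_ord orbT.
Qed.

(* ['C((L + j).-1, j)] counts the compositions of j into L parts >= 0; the
   truncated predecessor gives the right values 1, 0, 0, ... also for L = 0. *)
Lemma sum_compositions (L s : nat) :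
  \sum_(j < s.+1) 'C((L + j).-1, j) = 'C(L + s, s).
Proof.
elim: s => [|s IHs]; first by rewrite big_ord1 !bin0.
by rewrite big_ord_recr IHs /= addnS /= binS addnC.
Qed.

(** Absorption turns the summand into [L * 'C((L + j).-1, L)] for positive [j], which sums along a
    diagonal. *)
Lemma sum_mul_compositions (L s : nat) :
  \sum_(j < s.+1) j * 'C((L + j).-1, j) = L * 'C(L + s, L.+1).
Proof.
elim: s => [|s IHs]; first by rewrite big_ord1 mul0n addn0 bin_small ?muln0.
rewrite big_ord_recr IHs /= addnS /= binS mulnDr; congr (_ + _).
by rewrite mul_bin_left addnK -(bin_sub (leq_addr s L)) addKn.
Qed.

(** On the boundary both sides are 0. Otherwise the factor [L.+1 - k * (t + j)] is linear in [j], so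
    the sum in the recurrence splits into the two composition sums. *)
Lemma nb_blocksE (N k t L s : nat) :
  0 < k -> 0 < t -> L <= N -> k * (t + s) <= L.+1 ->
  nb_blocks N k t L (t + s) = (L.+1 - k * (t + s)) * 'C((L + s).-1, s).
Proof.
move=> k0 t0; elim: L s => [|L IHL] s leLN; rewrite leq_eqVlt => /orP[/eqP kr|].
- by rewrite kr subnn mul0n; apply: sum_config_eq0; rewrite ?kr.
- by rewrite ltnS leqn0 muln_eq0 (gtn_eqF k0) addn_eq0 (gtn_eqF t0).
- by rewrite kr subnn mul0n; apply: sum_config_eq0; rewrite ?kr.
rewrite ltnS => le; rewrite nb_blocks_rec //.
have leG : k * s <= L.+1 by apply: leq_trans le; rewrite leq_mul2l leq_addl orbT.
have G := nb_configE k0 (ltnW leLN) leG.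
have S0 := sum_compositions L s; have S1 := sum_mul_compositions L s.
have AE : 'C(L + s, s) = 'C(L + s, L).
  by rewrite -(bin_sub (leq_addl L s)) addnK.
have M := mulSn_bin_diag L s.
have S : \sum_(i < s.+1) nb_blocks N k t L (t + i) + k * t * 'C(L + s, s) +
    k * (L * 'C(L + s, L.+1)) = L.+1 * 'C(L + s, s).
  rewrite -S0 -S1 !big_distrr -!big_split /=; apply: eq_bigr => j _.
  have lej : k * (t + j) <= L.+1.
    by apply: leq_trans le; rewrite leq_mul2l leq_add2l -ltnS ltn_ord orbT.
  rewrite IHL ?(ltnW leLN) //; have := subnK lej; nia.
rewrite addSn /= AE in S *.
(* Adding G gives [(L + 2 - k t) C(L+s,L) - k (L+1) C(L+s,L+1)], and [M] turns the last product into
   [k s C(L+s,L)]. *)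
have : L.+2 - k * (t + s) + k * (t + s) = L.+2 by rewrite subnK // ltnW.
nia.
Qed.

(** * Full configurations and the theorem *)

(** Once every point is covered, a point under an arc of [B] lies in some block, and that block ends
    before the right end of the arc exactly when it does not cross [B] there. *)
Lemma in_NCkE (k n : nat) (P : {set {set 'I_(k * n)}}) :
  in_NCk P = config k (k * n) n P.
Proof.
have below_full : below (k * n) (k * n) = [set: 'I_(k * n)].
  by apply/setP=> x; rewrite !inE ltn_ord.
apply/and3P/configP => [[/and3P[/eqP cP tP P0] nc /forall_inP dvP]
                       | [[tP P0] _ cP dvP /nestedP nP]].
  split; rewrite ?cP ?below_full ?cardsT ?card_ord //.
  apply/nestedP=> B a b c BP aB cB ab bc bB.
  have bP : b \in cover P by rewrite cP inE.
  exists (pblock P b); split; rewrite ?pblock_mem ?mem_pblock // => d dB2.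
  have neB : B != pblock P b by apply: contra bB => /eqP ->; rewrite mem_pblock.
  rewrite ltnNge leq_eqVlt; apply/negP=> /orP[/eqP/val_inj cd | cd].
    have := def_pblock tP (pblock_mem bP) dB2.
    by rewrite -cd (def_pblock tP BP cB) => eB; rewrite eB eqxx in neB.
  move: nc => /forallP/(_ a)/forallP/(_ b)/forallP/(_ c)/forallP/(_ d).
  move=> /forall_inP/(_ B BP)/forall_inP/(_ _ (pblock_mem bP)).
  by rewrite ab bc cd neB aB cB mem_pblock bP dB2.
have cT : cover P = setT.
  by apply/eqP; rewrite eqEcard subsetT cP cardsT card_ord leqnn.
split.
- by rewrite /is_set_partition /partition cT eqxx tP P0.
- apply/forallP=> a; apply/forallP=> b; apply/forallP=> c; apply/forallP=> d.
  apply/forall_inP=> B1 B1P; apply/forall_inP=> B2 B2P.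
  apply/negP=> /and5P[ab bc cd ne12 /and4P[aB1 cB1 bB2 dB2]].
  have bB1 : b \notin B1.
    apply/negP=> bB1; move/eqP: ne12; apply.
    by rewrite -(def_pblock tP B1P bB1) (def_pblock tP B2P bB2).
  have [B3 [B3P bB3 /(_ d)]] := nP B1 a b c B1P aB1 cB1 ab bc bB1.
  rewrite -(def_pblock tP B3P bB3) (def_pblock tP B2P bB2) ltnNge ltnW //.
  by move/(_ dB2).
- by apply/forall_inP.
Qed.

Theorem theorem1 (k n t : nat) (hk : (0 < k)%N) (hn : (0 < n)%N) (ht : (0 < t)%N) :
  (\sum_(P : {set {set 'I_(k * n)}} | in_NCk P) #|[set B in P | #|B| == t * k]|)%N
  = binomZ ((n * (k + 1))%:Z - t%:Z - 1) ((n * k)%:Z - 1).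
Proof.
rewrite (eq_bigl _ _ (@in_NCkE k n)) -/(nb_blocks (k * n) k t (k * n) n).
have nk0 : 0 < n * k by rewrite muln_gt0 hn.
(* For [n < t] the upper index drops below the lower one, so the binomial takes its default value
   0. *)
rewrite /binomZ; case: (leqP t n) => [tn | nt]; last first.
  rewrite nb_blocks_lt // ifF //; apply/negP=> /andP[_]; lia.
have := @nb_blocksE (k * n) k t (k * n) (n - t) hk ht (leqnn _).
rewrite subnKC // => ->; last exact: leqnSn.
(* At [L = k * n], [r = n] the linear factor is 1; symmetry of the remaining binomial gives the
   stated form. *)
rewrite subSnn mul1n ifT; last by apply/andP; split; lia.
have -> : (k * n + (n - t)).-1 = (n * k).-1 + (n - t) by lia.
rewrite -(bin_sub (leq_addl (n * k).-1 (n - t))) addnK; congr 'C(_, _); lia.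
Qed.
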